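(* Let $(R,\mathfrak m)$ be a one-dimensional Cohen-Macaulay local ring and let $I_1,\ldots,I_s$ be $\mathfrak m$-primary ideals of $R$. Let $\mathcal F=\{\mathcal F(\underline n)\}_{\underline n\in\mathbb Z^s}$ be an $\underline I$-admissible filtration of ideals in $R$. Then the complete reduction number $r_{\mathcal A}(\mathcal F)$ of $\mathcal F$ with respect to a complete reduction $\mathcal A$ of $\mathcal F$ is independent of the choice of the complete reduction $\mathcal A$.
   Context: Notation: $\mathbb N=\{0,1,2,\ldots\}$, $s\ge1$, $e=(1,\ldots,1)\in\mathbb Z^s$; $\underline n\ge\underline m$ means componentwise inequality; $\underline n^+=(\max(n_1,0),\ldots,\max(n_s,0))$; $\underline I=(I_1,\ldots,I_s)$ and $\underline I^{\underline n}=I_1^{n_1}\cdots I_s^{n_s}$, where a nonpositive power of an ideal is $R$. ''For all large $\underline n$'' means for all $\underline n\in\mathbb N^s$ with every $n_i\gg0$. Filtrations: a $\mathbb Z^s$-graded $\underline I$-filtration is a family of ideals $\mathcal F=\{\mathcal F(\underline n)\}_{\underline n\in\mathbb Z^s}$ of $R$ with $\underline I^{\underline n}\subseteq\mathcal F(\underline n)$, $\mathcal F(\underline n)\mathcal F(\underline m)\subseteq\mathcal F(\underline n+\underline m)$, and $\mathcal F(\underline m)\subseteq\mathcal F(\underline n)$ whenever $\underline m\geq\underline n$. It is $\underline I$-admissible if moreover $\mathcal F(\underline n)=\mathcal F(\underline n^+)$ for all $\underline n$ and $\bigoplus_{\underline n\in\mathbb Z^s}\mathcal F(\underline n)\underline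 t^{\underline n}$ is a finite module over $\bigoplus_{\underline n\in\mathbb Z^s}\underline I^{\underline n}\underline t^{\underline n}$, where $t_1,\dots,t_s$ are indeterminates and $\underline t^{\underline n}=t_1^{n_1}\cdots t_s^{n_s}$. In dimension one, a set $\mathcal A=\{a_i\in I_i:i=1,\dots,s\}$ is a complete reduction of $\mathcal F$ if $J=(a_1\cdots a_s)$ satisfies $J\mathcal F(\underline n)=\mathcal F(\underline n+e)$ for all large $\underline n\in\mathbb N^s$. The complete reduction number $r_{\mathcal A}(\mathcal F)$ is the least $k\in\mathbb N$ such that $J\mathcal F(\underline n)=\mathcal F(\underline n+e)$ for all $\underline n\ge ke$. *)

(* Defs.v *)
From mathcomp Require Import all_boot all_order all_algebra finmap.
From mathcomp Require Import boolp classical_sets.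

Set Implicit Arguments.
Unset Strict Implicit.
Unset Printing Implicit Defensive.

Import Order.TTheory GRing.Theory Num.Theory.

Local Open Scope classical_set_scope.
Local Open Scope ring_scope.

(* Ideals are Prop-valued subsets, and the unit ideal is allowed: the ideals of
   mathcomp's ring_quotient are decidable and proper. *)

Definition is_ideal (R : comNzRingType) (I : set R) : Prop :=
  [/\ I 0,
      forall x y, I x -> I y -> I (x + y)
    & forall r x, I x -> I (r * x)].

Definition ideal_gen (R : comNzRingType) (X : set R) : set R :=
  smallest (@is_ideal R) X.

Definition ideal_mul (R : comNzRingType) (I J : set R) : set R :=
  ideal_gen [set x * y | x in I & y in J].

(* Negz k is -(k+1); nonpositive powers are the unit ideal. *)
Definition ideal_exp (R : comNzRingType) (I : set R) (n : int) : set R :=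
  match n with
  | Posz k => iter k (ideal_mul I) setT
  | Negz _ => setT
  end.

Definition radical (R : comNzRingType) (I : set R) : set R :=
  [set x | exists n : nat, I (x ^+ n)].

Definition prime_ideal (R : comNzRingType) (P : set R) : Prop :=
  [/\ is_ideal P, P <> setT & forall x y, P (x * y) -> P x \/ P y].

Definition maximal_ideal (R : comNzRingType) (M : set R) : Prop :=
  [/\ is_ideal M, M <> setT
    & forall J, is_ideal J -> M `<=` J -> J <> setT -> J = M].

Definition primary_ideal (R : comNzRingType) (Q : set R) : Prop :=
  [/\ is_ideal Q, Q <> setT
    & forall x y, Q (x * y) -> Q x \/ exists n : nat, Q (y ^+ n)].

Definition is_primary_to (R : comNzRingType) (P Q : set R) : Prop :=
  primary_ideal Q /\ radical Q = P.

Definition noetherian (R : comNzRingType) : Prop :=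
  forall I : set R, is_ideal I -> exists xs : seq R, I = ideal_gen [set` xs].

Definition is_local (R : comNzRingType) (m : set R) : Prop :=
  maximal_ideal m /\ forall M, maximal_ideal M -> M = m.

(* A chain p_0 < ... < p_n of primes, of length n. *)
Definition prime_chain (R : comNzRingType) (n : nat) (p : 'I_n.+1 -> set R) :
    Prop :=
  (forall i, prime_ideal (p i)) /\
  (forall i j : 'I_n.+1, (i < j)%N -> p i `<` p j).

Definition has_krull_dim (R : comNzRingType) (d : nat) : Prop :=
  (exists p : 'I_d.+1 -> set R, prime_chain p) /\
  (forall n (p : 'I_n.+1 -> set R), prime_chain p -> (n <= d)%N).

Definition regular_sequence (R : comNzRingType) (xs : seq R) : Prop :=
  ideal_gen [set` xs] <> setT /\
  forall i, (i < size xs)%N -> forall r : R,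
    ideal_gen [set` take i xs] (xs`_i * r) -> ideal_gen [set` take i xs] r.

Definition has_depth (R : comNzRingType) (m : set R) (d : nat) : Prop :=
  (exists xs : seq R,
     [/\ [set` xs] `<=` m, regular_sequence xs & size xs = d]) /\
  (forall xs : seq R,
     [set` xs] `<=` m -> regular_sequence xs -> (size xs <= d)%N).

Definition cohen_macaulay_local (R : comNzRingType) (m : set R) : Prop :=
  [/\ noetherian R, is_local m
    & exists d, has_krull_dim R d /\ has_depth m d].

Notation "''Zv_' s" := {ffun 'I_s -> int}
  (at level 8, s at level 2, format "''Zv_' s") : type_scope.

Definition vone (s : nat) : 'Zv_s := [ffun=> 1].

Definition vge (s : nat) (n m : 'Zv_s) : Prop := forall i, m i <= n i.

Definition vpos (s : nat) (n : 'Zv_s) : 'Zv_s := [ffun i => Num.max (n i) 0].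

Definition multi_exp (R : comNzRingType) (s : nat) (I : 'I_s -> set R)
    (n : 'Zv_s) : set R :=
  \big[@ideal_mul R/setT]_(i < s) ideal_exp (I i) (n i).

(* Laurent polynomials in t_1, ..., t_s, given by their coefficients. *)
Definition laurent (R : comNzRingType) (s : nat) : Type :=
  {fsfun 'Zv_s -> R with 0}.

(* The coefficient of t^n in f * g. *)
Definition laurent_mul_coef (R : comNzRingType) (s : nat) (f g : laurent R s)
    (n : 'Zv_s) : R :=
  \sum_(m <- finsupp f) f m * g (n - m).

(* The direct sum of the F(n) t^n, inside the Laurent polynomial ring. *)
Definition rees (R : comNzRingType) (s : nat) (F : 'Zv_s -> set R) :
    set (laurent R s) :=
  [set f : laurent R s | forall n, F n (f n)].

(* M is generated by finitely many elements g_j over the subring A. *)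
Definition finite_module (R : comNzRingType) (s : nat)
    (A M : set (laurent R s)) : Prop :=
  exists (k : nat) (g : 'I_k -> laurent R s),
    (forall j, M (g j)) /\
    (forall f, M f -> exists c : 'I_k -> laurent R s,
       (forall j, A (c j)) /\
       (forall n, f n = \sum_(j < k) laurent_mul_coef (c j) (g j) n)).

Definition is_filtration (R : comNzRingType) (s : nat) (I : 'I_s -> set R)
    (F : 'Zv_s -> set R) : Prop :=
  [/\ forall n, is_ideal (F n),
      forall n, multi_exp I n `<=` F n,
      forall n m, ideal_mul (F n) (F m) `<=` F (n + m)
    & forall m n, vge m n -> F m `<=` F n].

Definition is_admissible (R : comNzRingType) (s : nat) (I : 'I_s -> set R)
    (F : 'Zv_s -> set R) : Prop :=
  [/\ is_filtration I F,
      forall n, F n = F (vpos n)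
    & finite_module (rees (multi_exp I)) (rees F)].

(* J F(n) = F(n + e) for all n >= k e, where J = (a_1 ... a_s). *)
Definition reduces_from (R : comNzRingType) (s : nat) (F : 'Zv_s -> set R)
    (a : 'I_s -> R) (k : nat) : Prop :=
  forall n : 'Zv_s, vge n (vone s *+ k) ->
    ideal_mul (ideal_gen [set \prod_(i < s) a i]) (F n) = F (n + vone s).

(* "For all large n" means for all n >= k e, for some k. *)
Definition complete_reduction (R : comNzRingType) (s : nat)
    (I : 'I_s -> set R) (F : 'Zv_s -> set R) (a : 'I_s -> R) : Prop :=
  (forall i, I i (a i)) /\ exists k, reduces_from F a k.

Lemma complete_reduction_ex (R : comNzRingType) (s : nat)
    (I : 'I_s -> set R) (F : 'Zv_s -> set R) (a : 'I_s -> R) :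
  complete_reduction I F a -> exists k, `[< reduces_from F a k >].
Proof. by case=> _ [k hk]; exists k; apply/asboolP. Qed.

Definition reduction_number (R : comNzRingType) (s : nat) (I : 'I_s -> set R)
    (F : 'Zv_s -> set R) (a : 'I_s -> R) (ha : complete_reduction I F a) :
    nat :=
  ex_minn (complete_reduction_ex ha).

(* Main.v *)
Require Import Defs.
From mathcomp Require Import all_boot all_order all_algebra finmap.
From mathcomp Require Import boolp classical_sets.

(** Write [a] and [b] also for the products of the two given reductions.  It is
    enough that, degree by degree, [a F(n) = F(n + e)] implies
    [b F(n) = F(n + e)]: then the two sets of admissible [k] coincide, and so
    do their minima.

    Morally one compares lengths: [F(n) / a F(n)] has length [e(a) = e(b)],
    because [a F(n) = F(n + e) = b F(n)] for large [n].  The proof below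
    replaces lengths by the ascending chain condition.  In the total quotient
    ring put [u = b / a].  For a large degree [N] one has [u F(N) = F(N)], and
    if [a F(n) = F(n + e)] then [u F(n)] is contained in [F(n)], since
    [b F(n)] is contained in [F(n + e)].  Choose a regular [w] in [F(N)].  The
    modules [w u^-k F(n)] increase with [k] and all lie in [u^-k F(N) = F(N)],
    hence are ideals of the noetherian ring [R]; the chain stops, and
    cancelling [w u^-k] gives [u^-1 F(n) = F(n)], that is
    [a F(n) = b F(n)].  This is [noetherian_mul_sub], stated without
    fractions.

    Regularity is where the hypotheses on [R] enter.  Depth one gives a regular
    [z] in the maximal ideal; as every [I_i] is primary to that ideal, some
    power of [z] lies in each [F(n)].  In a degree where
    [F(n + e) = a F(n)] this power is a multiple of [a], so [a] is regular. *)

Set Implicit Arguments.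
Unset Strict Implicit.
Unset Printing Implicit Defensive.

Import Order.TTheory GRing.Theory Num.Theory.

Local Open Scope classical_set_scope.
Local Open Scope ring_scope.

Section Ideals.
Variable R : comNzRingType.
Implicit Types (I J G : set R) (x y z : R).

Lemma ideal_gen_sub (X J : set R) :
  is_ideal J -> X `<=` J -> ideal_gen X `<=` J.
Proof. by move=> hJ XJ x; apply; split. Qed.

Lemma sub_ideal_gen (X : set R) : X `<=` ideal_gen X.
Proof. by move=> x Xx J [_]; apply. Qed.

Lemma ideal_mul_mem I J x y : I x -> J y -> ideal_mul I J (x * y).
Proof. by move=> Ix Jy; apply: sub_ideal_gen; exists x => //; exists y. Qed.

Lemma is_ideal0 : is_ideal [set 0 : R].
Proof.
split=> //= [x y -> ->|r x ->]; first by rewrite addr0.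
by rewrite mulr0.
Qed.

Lemma is_ideal_scale z G : is_ideal G -> is_ideal [set z * g | g in G].
Proof.
move=> [G0 GD GM]; split.
- by exists 0 => //; rewrite mulr0.
- move=> _ _ [g Gg <-] [h Gh <-]; exists (g + h); first exact: GD.
  by rewrite mulrDr.
- move=> r _ [g Gg <-]; exists (r * g); first exact: GM.
  by rewrite mulrCA.
Qed.

Lemma is_ideal_colon z G : is_ideal G -> is_ideal [set y | G (z * y)].
Proof.
move=> [G0 GD GM]; split=> /= [|x y Gx Gy|r x Gx].
- by rewrite mulr0.
- by rewrite mulrDr; apply: GD.
- by rewrite mulrCA; apply: GM.
Qed.

Lemma ideal_mul_principal z G :
  is_ideal G -> ideal_mul (ideal_gen [set z]) G = [set z * g | g in G].
Proof.
move=> hG; have [_ _ GM] := hG; apply/seteqP; split; last first.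
  by move=> _ [g Gg <-]; apply: ideal_mul_mem => //; apply: sub_ideal_gen.
apply: ideal_gen_sub; first exact: is_ideal_scale.
move=> _ [x zx [g Gg <-]].
suff [r _ <-] : [set z * r | r in [set: R]] x.
  by exists (r * g); [exact: GM | rewrite mulrA].
apply: zx; split; first exact: is_ideal_scale.
by move=> _ ->; exists 1 => //; rewrite mulr1.
Qed.

(** The ascending chain condition, in the form in which it is used: the union
    of a chain of ideals has finitely many generators, and these already lie in
    one member of the chain. *)
Lemma noetherian_chain (L : nat -> set R) :
    noetherian R -> (forall k, is_ideal (L k)) ->
    (forall k, L k `<=` L k.+1) ->
  exists k, forall j, L j `<=` L k.
Proof.
move=> hN idL LS.
have Lle i j : (i <= j)%N -> L i `<=` L j.
  move=> /subnK <-; elim: (j - i)%N => [//|d IH]; exact: subset_trans (LS _).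
have idU : is_ideal [set x | exists k, L k x].
  split=> /=.
  - by exists 0%N; have [] := idL 0%N.
  - move=> x y [i Lx] [j Ly]; exists (maxn i j); have [_ LD _] := idL (maxn i j).
    by apply: LD; [apply: Lle Lx; rewrite leq_maxl
                  |apply: Lle Ly; rewrite leq_maxr].
  - by move=> r x [k Lx]; exists k; have [_ _ LM] := idL k; apply: LM.
have [xs Uxs] := hN _ idU.
have [k Lxs] : exists k, [set` xs] `<=` L k.
  have: [set` xs] `<=` [set x | exists k, L k x].
    by rewrite Uxs; apply: sub_ideal_gen.
  elim: xs {Uxs} => [|x xs IH] xsU; first by exists 0%N.
  have [i Lx] : exists i, L i x by apply: xsU; rewrite /= mem_head.
  have [|j Lxs] := IH.
    by move=> y /= y_xs; apply: xsU; rewrite /= in_cons y_xs orbT.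
  exists (maxn i j) => y /=; rewrite in_cons => /orP[/eqP->|y_xs].
    by apply: Lle Lx; rewrite leq_maxl.
  by apply: Lle (Lxs _ y_xs); rewrite leq_maxr.
exists k => j x Lx.
suff: [set y | exists k, L k y] x.
  by rewrite Uxs; apply: ideal_gen_sub Lxs _.
by exists j.
Qed.

(** When [b] is regular too, put [u = b / a]: [u] maps [G] into itself and
    [u^-1] maps [M] into itself, while [w] embeds [G] in [M].  The increasing
    modules [w u^-k G] all lie in [M], hence in [R], so they become constant and
    [u^-1] maps [G] into itself as well. *)
Lemma noetherian_mul_sub (G M : set R) (a b w : R) :
    noetherian R -> is_ideal G ->
    GRing.lreg a -> GRing.lreg w ->
    (forall g, G g -> M (w * g)) ->
    (forall x, M x -> exists2 y, M y & a * x = b * y) ->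
    (forall g, G g -> exists2 h, G h & b * g = a * h) ->
  forall g, G g -> exists2 h, G h & a * g = b * h.
Proof.
move=> hN hG ra rw wGM aMbM bGaG g Gg.
(* [L k] is [w u^-k G], cut down to [R] *)
pose L k := [set y | [set (a ^+ k * w) * h | h in G] (b ^+ k * y)].
have [k Lk] : exists k, forall j, L j `<=` L k.
  apply: noetherian_chain => // [k|k y [h Gh e]].
    exact/is_ideal_colon/is_ideal_scale.
  have [h' Gh' e'] := bGaG _ Gh.
  exists h' => //; rewrite [b ^+ _]exprS -[RHS]mulrA -e [RHS]mulrCA e'.
  by rewrite [RHS]mulrCA !mulrA -exprS.
have [y My ey] : exists2 y, M y & a ^+ k.+1 * (w * g) = b ^+ k.+1 * y.
  elim: k.+1 => [|j [y My ey]].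
    by exists (w * g); [exact: wGM | rewrite !expr0].
  have [y' My' ey'] := aMbM _ My.
  by exists y' => //; rewrite exprS -mulrA ey mulrCA ey' mulrA -exprSr.
have [h Gh eh] : L k y by apply: (Lk k.+1); exists g => //; rewrite -mulrA.
exists h => //; apply: (lregM (lregX (n := k) ra) rw).
rewrite [RHS]mulrCA eh [RHS]mulrA -exprS -ey exprSr.
by rewrite -!mulrA [a * (w * g)]mulrCA.
Qed.

End Ideals.

Section Filtrations.
Variables (R : comNzRingType) (s : nat) (I : 'I_s -> set R).

Lemma prod_mem_multi_exp (a : 'I_s -> R) :
  (forall i, I i (a i)) -> multi_exp I (vone s) (\prod_(i < s) a i).
Proof.
move=> Ia; rewrite /multi_exp.
apply: (big_ind2 (fun (A : set R) x => A x)) => // [A x B y|i _].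
  exact: ideal_mul_mem.
by rewrite ffunE -[a i]mulr1; apply: ideal_mul_mem.
Qed.

Lemma exp_mem_multi_exp z (n : 'Zv_s) :
  (forall i, radical (I i) z) -> exists p, multi_exp I n (z ^+ p).
Proof.
move=> Iz.
have PM (A B : set R) : (exists p, A (z ^+ p)) -> (exists p, B (z ^+ p)) ->
    exists p, ideal_mul A B (z ^+ p).
  by move=> [p Ap] [q Bq]; exists (p + q)%N; rewrite exprD; apply: ideal_mul_mem.
apply: (big_ind (fun A : set R => exists p, A (z ^+ p))) => // [|i _].
  by exists 0%N.
case: (n i) => k; last by exists 0%N.
by elim: k => [|k IH] /=; [exists 0%N | apply: PM => //; apply: Iz].
Qed.

End Filtrations.

Lemma has_krull_dim_inj (R : comNzRingType) (d d' : nat) :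
  has_krull_dim R d -> has_krull_dim R d' -> d = d'.
Proof.
move=> [[p hp] hd] [[q hq] hd']; apply/eqP.
by rewrite eqn_leq (hd' _ _ hp) (hd _ _ hq).
Qed.

Lemma cohen_macaulay_dim1_regular (R : comNzRingType) (m : set R) :
    cohen_macaulay_local m -> has_krull_dim R 1 ->
  exists2 z, m z & GRing.lreg z.
Proof.
move=> [_ _ [d [hd [[xs [xsm [_ reg] sz]] _]]]] h1.
rewrite -(has_krull_dim_inj h1 hd) in sz.
case: xs sz xsm reg => [|z []] //= _ zm reg; exists z.
  by apply: zm; rewrite /= mem_head.
move=> x y; have := reg 0%N isT (x - y); rewrite /= mulrBr => reg0 e.
apply/subr0_eq; suff: [set 0 : R] (x - y) by [].
apply: (ideal_gen_sub (is_ideal0 R) _ (reg0 _)) => //.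
by rewrite e subrr => J [[]].
Qed.

(** Here [noetherian_mul_sub] compares [G = F(n)] with [M = F(N)], where [N] is
    a degree from which both [a] and [b] reduce, so that [a M = b M]; a power
    of [z] serves as the regular element that multiplies [G] into [M]. *)
Lemma reduces_from_transfer (R : comNzRingType) (s : nat) (I : 'I_s -> set R)
    (F : 'Zv_s -> set R) (z : R) (a b : 'I_s -> R) (k : nat) :
    noetherian R -> is_filtration I F ->
    GRing.lreg z -> (forall i, radical (I i) z) ->
    complete_reduction I F a -> complete_reduction I F b ->
  reduces_from F a k -> reduces_from F b k.
Proof.
move=> hN [idF IF FM _] rz Iz [_ [ka hka]] [Ib [kb hkb]] hk n hn.
rewrite ideal_mul_principal //.
set b' := \prod_(i < s) b i; set a' := \prod_(i < s) a i.
have bF (n' : 'Zv_s) x : F n' x -> F (n' + vone s) (b' * x).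
  move=> Fx; rewrite addrC; apply: FM; apply: ideal_mul_mem Fx.
  exact/IF/prod_mem_multi_exp.
have hn1 := hk n hn; rewrite ideal_mul_principal // -/a' in hn1.
pose N : 'Zv_s := vone s *+ maxn ka kb.
have Nge j : (j <= maxn ka kb)%N -> vge N (vone s *+ j).
  by move=> le_j i; rewrite !ffunMnE ffunE ler_nat.
have haN := hka N (Nge _ (leq_maxl _ _)).
have hbN := hkb N (Nge _ (leq_maxr _ _)).
rewrite ideal_mul_principal // -/a' in haN.
rewrite ideal_mul_principal // -/b' in hbN.
have zF n' : exists p, F n' (z ^+ p).
  by have [p zp] := exp_mem_multi_exp n' Iz; exists p; apply: IF.
have ra : GRing.lreg a'.
  (* a power of [z] is a multiple of [a'], so [a'] is regular like [z] *)
  have [p] := zF (N + vone s); rewrite -haN => -[y _ zp] x x' e.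
  by apply: (lregX (n := p) rz); rewrite -zp ![a' * y]mulrC -!mulrA e.
apply/seteqP; split; first by move=> _ [x Fx <-]; apply: bF.
rewrite -hn1 => _ [g Fg <-]; have [p zp] := zF N.
suff [h Fh ->] : exists2 h, F n h & a' * g = b' * h by exists h.
apply: (@noetherian_mul_sub R (F n) (F N) a' b' (z ^+ p)) => //.
- exact: lregX.
- by move=> x _; have [_ _ FNM] := idF N; rewrite mulrC; apply: FNM.
- move=> x Fx; have : F (N + vone s) (a' * x) by rewrite -haN; exists x.
  by rewrite -hbN => -[y Fy <-]; exists y.
- by move=> x /bF; rewrite -hn1 => -[h Fh <-]; exists h.
Qed.

Theorem theorem5p4 (R : comNzRingType) (m : set R)
    (hCM : cohen_macaulay_local m) (hdim : has_krull_dim R 1)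
    (s : nat) (hs : (0 < s)%N)
    (I : 'I_s -> set R) (hI : forall i, is_primary_to m (I i))
    (F : 'Zv_s -> set R) (hF : is_admissible I F)
    (a b : 'I_s -> R)
    (ha : complete_reduction I F a) (hb : complete_reduction I F b) :
  reduction_number ha = reduction_number hb.
Proof.
have [z mz rz] := cohen_macaulay_dim1_regular hCM hdim.
have [hN _ _] := hCM; have [filtF _ _] := hF.
have Iz i : radical (I i) z by have [_ ->] := hI i.
apply: eq_ex_minn => k; apply/asboolP/asboolP.
  exact: (reduces_from_transfer hN filtF rz Iz ha hb).
exact: (reduces_from_transfer hN filtF rz Iz hb ha).
Qed.
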